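(* Let $n, A \ge 1$ be integers, let $\mathbf{K}_1,\dots,\mathbf{K}_A \in \mathbb{R}^{n\times n}$ be fixed symmetric positive semidefinite matrices, let $\mathcal{T}$ be a fixed finite set of triplets of indices in $\{1,\dots,n\}$, and let $\lambda_1,\lambda_2>0$. For a symmetric matrix $\mathbf{K}_0\in\mathbb{R}^{n\times n}$ and $\mu=(\mu_1,\dots,\mu_A)\in\mathbb{R}^A$ put $\mathbf{K}''=\mathbf{K}_0+\sum_{a=1}^A\mu_a\mathbf{K}_a$. Let $E(\cdot,\mathcal{T})$ be a real-valued error function of the kernel matrix. If $E(\mathbf{K}'',\mathcal{T})$ is a convex function of the variables $(\mathbf{K}_0,\mu)$, then the optimization problem $$\min_{\mathbf{K}_0,\,\mu}\; E(\mathbf{K}'',\mathcal{T})+\lambda_1\,\mathrm{trace}(\mathbf{K}_0)+\lambda_2\|\mu\|_1\quad\text{subject to}\quad \mathbf{K}_0\succeq 0,\ \mu\ge 0$$ is a convex optimization problem.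
   Context: The optimization variables are the symmetric matrix $\mathbf{K}_0\in\mathbb{R}^{n\times n}$ and the vector $\mu\in\mathbb{R}^A$. The constraint $\mathbf{K}_0\succeq 0$ means that $\mathbf{K}_0$ is positive semidefinite, $\mu\ge 0$ is meant entrywise, and $\|\mu\|_1=\sum_a|\mu_a|$. A minimization problem is called a convex optimization problem if its feasible set is convex and its objective is a convex function of the optimization variables on the feasible set. Convexity of $E(\mathbf{K}'',\mathcal{T})$ in the variables is understood on the set of pairs $(\mathbf{K}_0,\mu)$ with $\mathbf{K}_0\succeq0$, $\mu\ge0$. A triplet $(a,b,c)$ encodes the comparison ''object $a$ is more similar to object $b$ than to object $c$''. *)

(* Defs.v *)
From HB Require Import structures.
From mathcomp Require Import all_boot all_order all_algebra.
From mathcomp Require Import boolp classical_sets reals convex.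

Set Implicit Arguments.
Unset Strict Implicit.
Unset Printing Implicit Defensive.

Import Order.TTheory GRing.Theory Num.Theory.

Local Open Scope ring_scope.
Local Open Scope classical_set_scope.

Section MinimizationProblem.
Variables (R : realType) (V : lmodType R).

Record min_problem := MinProblem {
  feasible : set (convex_lmodType V);
  objective : convex_lmodType V -> R^o }.

Definition convex_problem (P : min_problem) : Prop :=
  convex_set (feasible P) /\ convex_function (feasible P) (objective P).

End MinimizationProblem.

Section KernelLearning.
Variables (R : realType) (n A : nat).

Definition psd (M : 'M[R]_n) : Prop :=
  M \is symmetricmx /\ forall x : 'rV[R]_n, 0 <= (x *m M *m x^T) 0 0.

Definition l1norm (mu : 'rV[R]_A) : R := \sum_a `|mu 0 a|.

(* (a, b, c) : object a is more similar to object b than to object c *)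
Definition triplet := ('I_n * 'I_n * 'I_n)%type.

Definition combined_kernel (K : 'I_A -> 'M[R]_n)
    (z : 'M[R]_n * 'rV[R]_A) : 'M[R]_n :=
  z.1 + \sum_a z.2 0 a *: K a.

(* A subset of Sym_n(R) x R^A, since psd includes symmetry. *)
Definition psd_nonneg : set ('M[R]_n * 'rV[R]_A) :=
  [set z : 'M[R]_n * 'rV[R]_A | psd z.1 /\ forall a, 0 <= z.2 0 a].

Definition kernel_problem (K : 'I_A -> 'M[R]_n)
    (E : 'M[R]_n -> {set triplet} -> R) (T : {set triplet})
    (lambda1 lambda2 : R) : min_problem ('M[R]_n * 'rV[R]_A)%type :=
  {| feasible := psd_nonneg;
     objective := fun z => E (combined_kernel K z) T
                           + lambda1 * \tr z.1 + lambda2 * l1norm z.2 |}.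

End KernelLearning.

Arguments psd_nonneg : clear implicits.

(* Main.v *)
Require Import Defs.
From HB Require Import structures.
From mathcomp Require Import all_boot all_order all_algebra.
From mathcomp Require Import boolp classical_sets reals convex.
From mathcomp Require Import interval_inference.

Import Order.TTheory GRing.Theory Num.Theory.

Local Open Scope ring_scope.
Local Open Scope classical_set_scope.

(** The feasible set is the product of the positive semidefinite cone and the nonnegative orthant;
    both are closed under nonnegative combinations ([psd_conic] for the first), so it is convex. The
    error term is convex by hypothesis, the trace is linear, and the l1 norm is convex by the
    triangle inequality. Nonnegative scaling and addition preserve convexity, which settles the
    objective. *)

Lemma convex_functionD (R : numFieldType) (V : lmodType R)
    (D : set (convex_lmodType V)) (f g : convex_lmodType V -> R^o) :
  convex_function D f -> convex_function D g ->
  convex_function D (fun x => f x + g x).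
Proof.
move=> cf cg t x y xD yD.
apply: le_trans (lerD (cf t x y xD yD) (cg t x y xD yD)) _.
by rewrite !convRE !mulrDr addrACA.
Qed.

Lemma convex_functionZ (R : numFieldType) (V : lmodType R)
    (D : set (convex_lmodType V)) (f : convex_lmodType V -> R^o) (c : R) :
  0 <= c -> convex_function D f -> convex_function D (fun x => c * f x).
Proof.
move=> c0 cf t x y xD yD; apply: le_trans (ler_wpM2l c0 (cf t x y xD yD)) _.
by rewrite !convRE mulrDr !(mulrCA c).
Qed.

(** Transposition and, for fixed [x], the value of the quadratic form at [x] are both linear in the
    matrix. *)
Lemma psd_conic (R : realType) (n : nat) (M N : 'M[R]_n) (s t : R) :
  0 <= s -> 0 <= t -> psd M -> psd N -> psd (s *: M + t *: N).
Proof.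
(* Symmetric matrices are encoded as Hermitian ones with trivial sign and identity conjugation. *)
have symE (B : 'M[R]_n) : (B \is symmetricmx) = (B == B^T).
  by rewrite is_hermitianmxE expr0 scale1r map_mx_id.
move=> s0 t0 [symM posM] [symN posN]; split=> [|x].
  move: symM symN; rewrite !symE linearD /= !linearZ /=.
  by move=> /eqP <- /eqP <-.
rewrite mulmxDr mulmxDl -!scalemxAr -!scalemxAl.
(* Only the sum and the two scalings are expanded, so that both quadratic forms keep the shape found
   in [posM] and [posN]. *)
rewrite mxE [X in X + _]mxE [X in _ + X]mxE.
by rewrite addr_ge0 // mulr_ge0.
Qed.

Lemma psd_nonneg_convex (R : realType) (n A : nat) :
  @convex_set R ('M[R]_n * 'rV[R]_A)%type (psd_nonneg R n A).
Proof.
move=> z w t; rewrite !in_setE => -[psdz z0] [psdw w0].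
(* The weight [t] carries its bounds 0 and 1 in its type, so both coefficients are nonnegative. *)
have t0 : 0 <= t%:inum by [].
have s0 : 0 <= 1 - t%:inum by rewrite subr_ge0.
split=> [|a]; first exact: psd_conic.
by rewrite !mxE addr_ge0 // mulr_ge0.
Qed.

(** By linearity the convexity inequality is an equality, on any domain. *)
Lemma mxtrace_fst_convex (R : realType) (n : nat) (V : lmodType R)
    (D : set (convex_lmodType ('M[R]_n * V)%type)) :
  convex_function D (fun z => \tr z.1).
Proof. by move=> t z w _ _; rewrite mxtraceD !mxtraceZ. Qed.

Lemma l1norm_snd_convex (R : realType) (A : nat) (V : lmodType R)
    (D : set (convex_lmodType (V * 'rV[R]_A)%type)) :
  convex_function D (fun z => l1norm z.2).
Proof.
move=> t z w _ _; rewrite convRE /l1norm !mulr_sumr -big_split /=.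
have t0 : 0 <= t%:inum by [].
have s0 : 0 <= 1 - t%:inum by rewrite subr_ge0.
(* Triangle inequality in each coordinate; the nonnegative weights then come out of the absolute
   values. *)
apply: ler_sum => a _; rewrite !mxE; apply: le_trans (ler_normD _ _) _.
by rewrite !normrM (ger0_norm t0) (ger0_norm s0).
Qed.

Theorem proposition1 (R : realType) (n A : nat) (n_gt0 : (0 < n)%N)
    (A_gt0 : (0 < A)%N) (K : 'I_A -> 'M[R]_n) (K_psd : forall a, psd (K a))
    (E : 'M[R]_n -> {set triplet n} -> R) (T : {set triplet n})
    (lambda1 lambda2 : R) (lambda1_gt0 : 0 < lambda1)
    (lambda2_gt0 : 0 < lambda2)
    (E_convex : @convex_function R ('M[R]_n * 'rV[R]_A)%type
       (psd_nonneg R n A) (fun z => E (combined_kernel K z) T)) :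
  convex_problem (kernel_problem K E T lambda1 lambda2).
Proof.
split; first exact: psd_nonneg_convex.
apply: convex_functionD; first apply: convex_functionD => //.
- by apply: convex_functionZ (ltW lambda1_gt0) _; exact: mxtrace_fst_convex.
- by apply: convex_functionZ (ltW lambda2_gt0) _; exact: l1norm_snd_convex.
Qed.
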